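(* Let $\mu \in \mathscr{P}(\mathbb{R})$, and let $F_{\mu} : \mathbb{R} \to [0,1]$ be the function $F_{\mu}(x) := \mu((-\infty,x])$. The following are equivalent: (1) $W_1(\mu,\mu_h) = o(h)$ as $h\searrow 0$; (2) for any vanishing sequence $(h_n)_{n \in \mathbb{N}} \subset (0,1]$, there exist a subsequence $(h_{n_k})_{k \in \mathbb{N}}$ and $g \in L^1(\mathbb{R};\mathbb{R}^+)$ such that $$\left|\frac{\frac{1}{2} \left[F_{\mu}(x-h_{n_k}) + F_{\mu}(x + h_{n_k})\right] - F_{\mu}(x)}{h_{n_k}}\right| \leqslant g(x) \qquad \text{for almost every } x \in \mathbb{R} \text{ and any } k \in \mathbb{N}.$$
   Context: $\mathscr{P}(\mathbb{R})$ is the set of Borel probability measures on $\mathbb{R}$. $W_1(\mu,\nu):=\inf_\eta\int_{\mathbb{R}^2}|x-y|\,d\eta(x,y)\in[0,\infty]$, the infimum running over Borel probability measures $\eta$ on $\mathbb{R}^2$ with marginals $\mu$ and $\nu$ (no moment condition imposed). For $h>0$, $\mu_h:=\frac12\left[(\mathrm{id}-h)_\#\mu+(\mathrm{id}+h)_\#\mu\right]$, with $f_\#\mu$ the pushforward. A vanishing sequence is a nonincreasing sequence of positive numbers converging to $0$. ''Almost every'' and $L^1$ refer to the Lebesgue measure on $\mathbb{R}$. *)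

(* Defs.v *)
From HB Require Import structures.
From mathcomp Require Import all_boot all_order all_algebra.
From mathcomp Require Import all_classical all_reals all_analysis.
From mathcomp Require Import measurable_realfun.

Set Implicit Arguments.
Unset Strict Implicit.
Unset Printing Implicit Defensive.

Import Order.TTheory GRing.Theory Num.Theory.
Import numFieldNormedType.Exports.

Local Open Scope classical_set_scope.
Local Open Scope ring_scope.

(** [measurableTypeR R] is [R] with its Borel
    sigma-algebra, so [probability (measurableTypeR R) R] is P(R); the product
    [measurableTypeR R * measurableTypeR R] carries the product
    sigma-algebra, which is the Borel sigma-algebra of the plane. *)

Definition translate {R : realType} (a : R) :
  measurableTypeR R -> measurableTypeR R := fun x => x + a.

Section translate_measurable.
Context {R : realType} (a : R).

Lemma measurable_translate :
  measurable_fun [set: measurableTypeR R] (translate a).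
Proof.
by apply: measurable_funD => //; exact: measurable_cst.
Qed.

HB.instance Definition _ := isMeasurableFun.Build _ _ _ _ (translate a)
  measurable_translate.

End translate_measurable.

Section symmetric_shift.
Local Open Scope ereal_scope.
Context {R : realType} (mu : probability (measurableTypeR R) R) (h : R).

(** [distribution mu X] is the pushforward of [mu] by [X]. *)
Definition shift_avg_fun : set (measurableTypeR R) -> \bar R :=
  mscale (2^-1)%:nng%R
    (measure_add (distribution mu (translate (- h)))
                 (distribution mu (translate h))).

Lemma shift_avg_funE (A : set (measurableTypeR R)) :
  shift_avg_fun A = (2^-1)%:E *
    (pushforward mu (fun x => (x - h)%R) A +
     pushforward mu (fun x => (x + h)%R) A).
Proof. by congr (_ * _); exact: measure_addE. Qed.

HB.instance Definition _ := Measure.on shift_avg_fun.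

Lemma shift_avg_setT : shift_avg_fun [set: _] = 1.
Proof.
rewrite shift_avg_funE /pushforward !preimage_setT !probability_setT.
by rewrite -EFinD -EFinM mulVf.
Qed.

HB.instance Definition _ := Measure_isProbability.Build _ _ _
  shift_avg_fun shift_avg_setT.

Definition shift_avg : probability (measurableTypeR R) R := shift_avg_fun.

End symmetric_shift.

(** Measures are total functions on sets here, whence the restriction of the
    marginal conditions to measurable sets. *)
Definition coupling {R : realType} (mu nu : probability (measurableTypeR R) R) :
    set (probability (measurableTypeR R * measurableTypeR R)%type R) :=
  [set eta | forall A : set (measurableTypeR R), measurable A ->
     pushforward eta fst A = mu A /\ pushforward eta snd A = nu A].

Definition W1 {R : realType} (mu nu : probability (measurableTypeR R) R) :
    \bar R :=
  ereal_inf [set (\int[eta]_z (`|z.1 - z.2|%R)%:E)%E | eta in coupling mu nu].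

Definition distr_fun {R : realType} (mu : probability (measurableTypeR R) R)
  (x : R) : R := fine (mu (`]-oo, x]%classic : set R)).

Definition vanishing_seq {R : realType} (h : nat -> R) : Prop :=
  [/\ nonincreasing_seq h, forall n, 0 < h n & h n @[n --> \oo] --> (0 : R)].

(* Main.v *)
From HB Require Import structures.
Require Import Defs.
From mathcomp Require Import all_boot all_order all_algebra.
From mathcomp Require Import all_classical all_reals all_analysis.
From mathcomp Require Import measurable_realfun ring lra.

(** Why the equivalence holds.

    On the line, the transport cost is read off the distribution functions:
    W1 mu nu is the integral of |F_mu - F_nu| ([W1E]). Every coupling costs at
    least that much, by a layer-cake argument, and the pair of quantile
    functions attains it. The distribution function of the symmetric average
    mu_h is the average of F_mu (x - h) and F_mu (x + h), so W1 mu mu_h / h is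
    exactly the L^1 norm of the second difference quotient of F_mu with step h
    ([W1_shift_avg]), and the first condition says that these quotients tend to
    0 in L^1.

    If they do, a subsequence has norms bounded by a geometric sequence, and
    the sum of its absolute values is an integrable dominating function
    ([summable_dominated]).

    Conversely, if the first condition fails, some vanishing sequence of steps
    keeps the L^1 norms above a positive number ([bad_vanishing_seq]); this is
    impossible along a dominated subsequence ([dominated_second_quotient]). One
    could prove the latter by dominated convergence, monotone functions being
    differentiable almost everywhere. That theorem is avoided here by cutting
    mu into three pieces ([concentration_split]), which depend on the accuracy
    that is aimed at:
    - a piece with bounded density and bounded support, whose quotients tend
      to 0 in L^1 because an indefinite integral is differentiable almost
      everywhere ([cvg_integral_second_quotient_distr_on]);
    - a piece lying in an open set U of small Lebesgue measure, at a positive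
      distance from the complement of U: its quotients vanish outside U as soon
      as the step is shorter than that distance
      ([second_quotient_distr_on_off]), while over U the quotients of F_mu cost
      no more than the integral of g over U, which is small by absolute
      continuity of the integral;
    - a piece of small mass, whose quotients have L^1 norm at most that mass,
      whatever the step ([integral_second_quotient_distr_on_le]).
    The first piece comes from a Hahn decomposition of mu - c lambda, where
    lambda is the Lebesgue measure of a large bounded interval: the rest of
    this interval has Lebesgue measure at most 1 / c, hence an open
    neighborhood U of small measure once c is large. *)

Import Order.TTheory GRing.Theory Num.Theory.
Import numFieldNormedType.Exports.

Local Open Scope classical_set_scope.
Local Open Scope ring_scope.

(** * Layer-cake formula for the mean distance *)

Section layer_cake.
Context {R : realType} d (T : measurableType d).
Variables X Y : T -> R.
Hypotheses (mX : measurable_fun setT X) (mY : measurable_fun setT Y).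

Let A : set (T * measurableTypeR R) :=
  [set z | (X z.1 <= z.2) (+) (Y z.1 <= z.2)].

Let xsectionA w : lebesgue_measure (xsection A w) = (`|X w - Y w|)%:E.
Proof.
have -> : xsection A w =
    `[Num.min (X w) (Y w), Num.max (X w) (Y w)[%classic.
  apply/seteqP; split=> t; rewrite set_itvE /xsection/= !inE /A/= ge_min lt_max;
    by rewrite !ltNge; case: (X w <= t); case: (Y w <= t).
rewrite lebesgue_measure_itv/= lte_fin.
have [XY|YX] := leP (X w) (Y w); last by rewrite YX gtr0_norm// subr_gt0.
rewrite ler0_norm ?subr_le0// opprB; case: ltP => // YX.
by rewrite (@le_anti _ _ (X w) (Y w)) ?subrr// XY.
Qed.

Let ysectionA t : ysection A t = [set w | (X w <= t) (+) (Y w <= t)].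
Proof. by apply/seteqP; split=> w; rewrite /ysection/= !inE. Qed.

Let mA : measurable A.
Proof.
have mle (Z : T -> R) : measurable_fun setT Z ->
    measurable [set z : T * measurableTypeR R | Z z.1 <= z.2].
  move=> mZ; rewrite -[X in measurable X]setTI.
  have : measurable_fun setT (fun z : T * measurableTypeR R => Z z.1 <= z.2).
    apply: measurable_fun_ler; last exact: measurable_snd.
    exact: measurableT_comp mZ measurable_fst.
  by move=> /(_ measurableT [set true]); apply.
have -> : A = ([set z | X z.1 <= z.2] `\` [set z | Y z.1 <= z.2]) `|`
              ([set z | Y z.1 <= z.2] `\` [set z | X z.1 <= z.2]).
  apply/seteqP; split=> z; rewrite /A /=;
    by case: (X z.1 <= z.2); case: (Y z.1 <= z.2); intuition.
by apply: measurableU; apply: measurableD; exact: mle.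
Qed.

Variable m : {sigma_finite_measure set T -> \bar R}.

Lemma measurable_layer :
  measurable_fun [set: measurableTypeR R]
    (fun t => m [set w | (X w <= t) (+) (Y w <= t)]).
Proof.
under eq_fun do rewrite -ysectionA.
exact: (@measurable_fun_ysection _ _ T (measurableTypeR R) R m A).
Qed.

(** The distance |a - b| is the length of the set of levels t that separate a
    from b, and Tonelli exchanges the two integrals. A sigma-finite measure is
    allowed because the formula is applied both to couplings and to
    restrictions of probability measures. *)
Lemma integral_dist_layer_cake :
  (\int[m]_w (`|X w - Y w|)%:E =
   \int[lebesgue_measure]_t m [set w | (X w <= t)%R (+) (Y w <= t)%R])%E.
Proof.
have := @indic_fubini_tonelli _ _ T (measurableTypeR R) R m lebesgue_measure A mA.
rewrite indic_fubini_tonelli_FE// indic_fubini_tonelli_GE//.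
under eq_integral do rewrite /= xsectionA.
by move=> ->; apply: eq_integral => t _ /=; rewrite ysectionA.
Qed.

End layer_cake.

(** * Distribution functions and quantiles *)

Section distr_on.
Context {R : realType} (mu : probability (measurableTypeR R) R).

(** The distribution function of the restriction of [mu] to [A]. Restrictions
    are not probability measures, but only their distribution functions
    matter. *)
Definition distr_on (A : set (measurableTypeR R)) (x : R) : R :=
  fine (mu (`]-oo, x]%classic `&` A)).

Lemma distr_onT : distr_on setT = distr_fun mu.
Proof. by apply/funext => x; rewrite /distr_on setIT. Qed.

Lemma distr_onE A x : measurable A ->
  (distr_on A x)%:E = mu (`]-oo, x]%classic `&` A).
Proof. by move=> mA; rewrite fineK// fin_num_measure//; exact: measurableI. Qed.

Lemma distr_onU A B : measurable A -> measurable B -> [disjoint A & B] ->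
  distr_on (A `|` B) = distr_on A \+ distr_on B.
Proof.
move=> mA mB /disj_setPS AB; apply/funext => x; apply: EFin_inj => /=.
rewrite EFinD !distr_onE//; last exact: measurableU.
rewrite setIUr measureU//; try exact: measurableI.
by apply/seteqP; split => // y [[_ Ay] [_ By]]; exact: AB.
Qed.

Lemma distr_onB A a b : measurable A -> a <= b ->
  (distr_on A b - distr_on A a)%:E = mu (`]a, b]%classic `&` A).
Proof.
move=> mA ab; rewrite EFinB !distr_onE//.
have -> : `]-oo, b]%classic `&` A =
    (`]-oo, a]%classic `&` A) `|` (`]a, b]%classic `&` A) :> set R.
  rewrite -setIUl; congr (_ `&` _); apply/seteqP; split => x; rewrite !set_itvE/=.
    by have [xa|ax] := leP x a; [left|right].
  by case=> [/le_trans|/andP[]//]; apply.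
rewrite measureU//; try exact: measurableI.
  by rewrite addeAC subee ?add0e// fin_num_measure//; exact: measurableI.
apply/seteqP; split => // y; rewrite !set_itvE/= => -[[ya _] [/andP[ay _] _]].
by move: (le_lt_trans ya ay); rewrite ltxx.
Qed.

Lemma distr_on_nondecreasing A : measurable A -> nondecreasing (distr_on A).
Proof. by move=> mA a b ab; rewrite -subr_ge0 -lee_fin distr_onB. Qed.

Lemma measurable_distr_on A : measurable A -> measurable_fun setT (distr_on A).
Proof.
by move=> mA; apply: nondecreasing_measurable => //;
  exact: distr_on_nondecreasing.
Qed.

End distr_on.

Section distr_fun.
Context {R : realType} (mu : probability (measurableTypeR R) R).

Let X : measurableTypeR R -> R := idfun.

#[local] HB.instance Definition _ :=
  @isMeasurableFun.Build _ _ _ _ X (@measurable_id _ _ setT).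

Lemma distr_funE x : (distr_fun mu x)%:E = mu `]-oo, x]%classic.
Proof. by rewrite /distr_fun fineK// fin_num_measure. Qed.

Let distr_fun_cdf : distr_fun mu = fine \o cdf (X : {RV mu >-> R}).
Proof. by apply/funext. Qed.

Lemma distr_fun_ge0 x : 0 <= distr_fun mu x.
Proof. by rewrite -lee_fin distr_funE. Qed.

Lemma distr_fun_le1 x : distr_fun mu x <= 1.
Proof. by rewrite -lee_fin distr_funE probability_le1. Qed.

Lemma distr_fun_nondecreasing : nondecreasing (distr_fun mu).
Proof. by rewrite -distr_onT; exact: distr_on_nondecreasing. Qed.

Lemma measurable_distr_fun : measurable_fun [set: R] (distr_fun mu).
Proof. by rewrite -distr_onT; exact: measurable_distr_on. Qed.

Lemma distr_fun_right_continuous : right_continuous (distr_fun mu).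
Proof.
move=> x; rewrite distr_fun_cdf; apply: fine_cvg.
rewrite /= fineK ?fin_num_measure//.
exact: cdf_right_continuous.
Qed.

Lemma distr_fun_cvgNy : distr_fun mu x @[x --> -oo] --> (0 : R).
Proof. by rewrite distr_fun_cdf; apply/fine_cvg/cvg_cdfNy0. Qed.

Lemma distr_fun_cvgy : distr_fun mu x @[x --> +oo] --> (1 : R).
Proof. by rewrite distr_fun_cdf; apply/fine_cvg/cvg_cdfy1. Qed.

End distr_fun.

Lemma measure_itvoc {R : realType} (mu : probability (measurableTypeR R) R)
    (a b : R) : a <= b ->
  mu `]a, b]%classic = (distr_fun mu b - distr_fun mu a)%:E.
Proof. by move=> ab; rewrite -distr_onT distr_onB// setIT. Qed.

(** Half-open intervals form a pi-system that generates the Borel sets. *)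
Lemma eq_probability_distr_fun {R : realType}
    (mu nu : probability (measurableTypeR R) R) :
  distr_fun mu =1 distr_fun nu ->
  forall A : set (measurableTypeR R), measurable A -> mu A = nu A.
Proof.
move=> munu A mA.
apply: (@measure_unique _ R (measurableTypeR R) (@ocitv R)
  (fun n => `](- n%:R)%R, n%:R]%classic)) => //.
- exact: ocitvI.
- by move=> n; exact: is_ocitv.
- exact: bigcup_itvT.
- move=> _ [[a b] _ <-] /=; have [ab|ba] := leP a b.
    by rewrite !measure_itvoc// !munu.
  by rewrite set_itv_ge ?measure0// bnd_simp -leNgt ltW.
- by move=> n; rewrite -ge0_fin_numE// fin_num_measure.
Qed.

Section quantile.
Context {R : realType} (mu : probability (measurableTypeR R) R).

(** Only the levels in ]0, 1[ matter: outside, the set may be empty or unbounded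
    below, and the value 0 keeps the function measurable. *)
Definition quantile (u : R) : R :=
  if u \in `]0, 1[ then inf [set x | u <= distr_fun mu x] else 0.

(** The Galois connection between the quantile and the distribution function.
    Right continuity makes the infimum attained, which gives the equality with
    non-strict inequalities on both sides. *)
Lemma quantile_le u t : u \in `]0, 1[ ->
  (quantile u <= t) = (u <= distr_fun mu t).
Proof.
move=> u01; rewrite /quantile u01; move: u01; rewrite in_itv/= => /andP[u0 u1].
have nonempty : [set x | u <= distr_fun mu x] !=set0.
  have /cvgrPdist_lt/(_ (1 - u)) := distr_fun_cvgy mu.
  rewrite subr_gt0 => /(_ u1)[M [_ /(_ (M + 1))]].
  rewrite ltrDl ltr01 => /(_ isT) H; exists (M + 1) => /=.
  by move: H; rewrite ger0_norm ?subr_ge0 ?distr_fun_le1//; lra.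
have has_lb : has_lbound [set x | u <= distr_fun mu x].
  have /cvgrPdist_lt/(_ u u0) := distr_fun_cvgNy mu.
  move=> [M [_ /(_ (M - 1))]].
  rewrite gtrDl ltrN10 => /(_ isT) H; exists (M - 1) => x /= ux.
  rewrite leNgt; apply/negP => /ltW/(distr_fun_nondecreasing mu).
  move: H; rewrite sub0r normrN ger0_norm ?distr_fun_ge0// => H1 H2.
  by have := le_lt_trans (le_trans ux H2) H1; rewrite ltxx.
apply/idP/idP => [|ut]; last by apply: inf_lbound.
apply: contraTT; rewrite -!ltNge => tu.
have /cvgrPdist_lt/(_ (u - distr_fun mu t)) := distr_fun_right_continuous mu t.
rewrite subr_gt0 => /(_ tu) nearF.
have [s ts Fs] : exists2 s, t < s & distr_fun mu s < u.
  near t^'+ => s; exists s => //.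
  have : `|distr_fun mu t - distr_fun mu s| < u - distr_fun mu t by near: s.
  have : distr_fun mu t <= distr_fun mu s by exact/distr_fun_nondecreasing/ltW.
  by move=> ?; rewrite ler0_norm ?subr_le0// opprB ltrD2r.
apply: (lt_le_trans ts); apply: lb_le_inf => // x /= ux.
rewrite leNgt; apply/negP => /ltW/(distr_fun_nondecreasing mu) xs.
by have := le_lt_trans (le_trans ux xs) Fs; rewrite ltxx.
Unshelve. all: by end_near. Qed.

Lemma measurable_quantile : measurable_fun [set: measurableTypeR R] quantile.
Proof.
have -> : quantile = (fun u => if u \in `]0, 1[ then quantile u else 0).
  by apply/funext => u; rewrite /quantile; case: ifP.
have m01 : measurable_fun [set: measurableTypeR R] (fun u : R => u \in `]0, 1[).
  apply: (@measurable_fun_bool _ (measurableTypeR R) _ _ true).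
  rewrite setTI (_ : _ @^-1` _ = `]0, 1[%classic)//.
apply: measurable_fun_if => //.
rewrite setTI (_ : _ @^-1` _ = `]0, 1[%classic)//.
apply: (measurability (@RGenOInfty.G R)); first exact: RGenOInfty.measurableE.
move=> _ [_ [t ->] <-].
have -> : `]0, 1[ `&` quantile @^-1` `]t, +oo[ =
          `]0, 1[ `&` `]distr_fun mu t, +oo[ :> set R.
  rewrite !set_itvoy; apply/seteqP; split => u /=.
    by move=> [u01]; rewrite ltNge quantile_le// -ltNge.
  by move=> [u01]; rewrite ltNge -quantile_le// -ltNge.
by apply: measurableI.
Qed.

End quantile.

Section unit_lebesgue.
Context {R : realType}.

Let m01 : measurable (`]0%R, 1%R[%classic : set (measurableTypeR R)).
Proof. exact: measurable_itv. Qed.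

(** The uniform law on ]0, 1[, the source space of the quantile coupling. *)
Definition unit_lebesgue : set (measurableTypeR R) -> \bar R :=
  mrestr (@lebesgue_measure R) m01.

HB.instance Definition _ := Measure.on unit_lebesgue.

Let unit_lebesgue_setT : unit_lebesgue [set: _] = 1%E.
Proof.
by rewrite /unit_lebesgue /mrestr setTI lebesgue_measure_itv/= lte_fin ltr01 sube0.
Qed.

HB.instance Definition _ :=
  Measure_isProbability.Build _ _ _ unit_lebesgue unit_lebesgue_setT.

End unit_lebesgue.

Lemma unit_lebesgueE {R : realType} (A : set (measurableTypeR R)) :
  unit_lebesgue A = lebesgue_measure (A `&` `]0, 1[).
Proof. by []. Qed.

Lemma unit_lebesgue_itv {R : realType} (a b : R) : 0 <= a -> a <= b -> b <= 1 ->
  unit_lebesgue (`]a, b]%classic : set (measurableTypeR R)) = (b - a)%:E.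
Proof.
move=> a0 ab b1; rewrite unit_lebesgueE.
have [b1'|] := ltP b 1.
  rewrite setIidl; last first.
    by move=> x; rewrite !set_itvE/= => /andP[ax xb]; apply/andP; split; lra.
  rewrite lebesgue_measure_itv/= lte_fin; case: ltP => // ba.
  by rewrite (@le_anti _ _ a b) ?subrr// ab.
move=> b1'; have {b1' b1}b1 : b = 1 by lra.
rewrite {b}b1 in ab *.
have -> : (`]a, 1] `&` `]0, 1[ = `]a, 1[ :> set R)%classic.
  apply/seteqP; split => x; rewrite !set_itvE/=; first by case => /andP[-> _] /andP[].
  by move=> /andP[ax x1]; rewrite ax x1 (ltW x1) (le_lt_trans a0 ax).
rewrite lebesgue_measure_itv/= lte_fin; case: ltP => // ba.
by rewrite (_ : 1 - a = 0)//; lra.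
Qed.

(** * The Wasserstein distance through distribution functions *)

(** The boolean exclusive or describes the symmetric difference of [A] and [B],
    in the shape that the layer-cake formula produces. *)
Lemma dist_measure_le_addb {R : realType} d (T : measurableType d) (P : probability T R)
    (A B : set T) : measurable A -> measurable B ->
  ((`|fine (P A) - fine (P B)|)%:E <= P [set w | (w \in A) (+) (w \in B)])%E.
Proof.
move=> mA mB.
wlog BA : A B mA mB / fine (P B) <= fine (P A).
  move=> H; have [/H|/ltW/H] := leP (fine (P B)) (fine (P A)); first exact.
  move=> /(_ mB mA); rewrite distrC => /le_trans; apply.
  by rewrite le_eqVlt; apply/orP; left; apply/eqP; congr (P _);
    apply/seteqP; split => w /=; rewrite addbC.
rewrite ger0_norm ?subr_ge0// EFinB !fineK ?fin_num_measure//.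
have -> : [set w | (w \in A) (+) (w \in B)] = (A `\` B) `|` (B `\` A).
  apply/seteqP; split => w /=.
    case: (boolP (w \in A)); case: (boolP (w \in B)) => //;
      rewrite !(inE, notin_setE); tauto.
  move=> [[Aw Bw]|[Bw Aw]]; first by rewrite mem_set// memNset.
  by rewrite memNset// mem_set.
rewrite leeBlDr ?fin_num_measure//.
apply: (@le_trans _ _ (P ((A `\` B) `|` (B `\` A) `|` B))).
  rewrite le_measure ?inE//.
  - by repeat apply: measurableU => //; exact: measurableD.
  - by move=> w Aw; have [Bw|Bw] := pselect (B w); [right|left; left].
by apply: measureU2 => //; apply: measurableU; exact: measurableD.
Qed.

Section W1E.
Context {R : realType} (mu nu : probability (measurableTypeR R) R).
Let F := distr_fun mu.
Let G := distr_fun nu.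

(** For each level t, a coupling gives to the set where exactly one coordinate
    is below t a mass at least the difference of the marginal masses. *)
Lemma W1_ge : (\int[lebesgue_measure]_t (`|F t - G t|)%:E <= W1 mu nu)%E.
Proof.
apply: le_ereal_inf_tmp => _ [eta eta_coupling <-].
have mfst : measurable_fun setT (@fst (measurableTypeR R) (measurableTypeR R)).
  exact: measurable_fst.
have msnd : measurable_fun setT (@snd (measurableTypeR R) (measurableTypeR R)).
  exact: measurable_snd.
rewrite (@integral_dist_layer_cake _ _ _ _ _ mfst msnd eta).
apply: ge0_le_integral => //.
- apply/measurable_EFinP/measurableT_comp => //.
  by apply: measurable_funB; exact: measurable_distr_fun.
- exact: (@measurable_layer _ _ _ _ _ mfst msnd eta).
move=> t _ /=.
have [etafst etasnd] := eta_coupling _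
  (measurable_itv `]-oo, t] : measurable (_ : set (measurableTypeR R))).
rewrite /F /G /distr_fun -etafst -etasnd /pushforward.
apply: le_trans (@dist_measure_le_addb _ _ _ eta _ _ _ _) _.
- by rewrite -[X in measurable X]setTI; exact: mfst.
- by rewrite -[X in measurable X]setTI; exact: msnd.
rewrite le_eqVlt; apply/orP; left; apply/eqP; congr (eta _).
by apply/seteqP; split => z; rewrite /= !mem_setE /= ?in_itv.
Qed.

Let unit_lebesgue_quantile_le (m : probability (measurableTypeR R) R) t :
  unit_lebesgue [set u | quantile m u <= t] = (distr_fun m t)%:E.
Proof.
rewrite -(subr0 (distr_fun m t)) -(@unit_lebesgue_itv _ 0)//;
  [|exact: distr_fun_ge0|exact: distr_fun_le1].
rewrite !unit_lebesgueE; congr (_ _); rewrite !set_itvE.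
apply/seteqP; split => u /= [] + u01; have u01' : u \in `]0, 1[ by rewrite in_itv.
  by rewrite quantile_le//= => ->; move: u01 => /andP[->].
by rewrite quantile_le// => /andP[].
Qed.

HB.instance Definition _ (m : probability (measurableTypeR R) R) :=
  isMeasurableFun.Build _ _ _ _ (quantile m : measurableTypeR R -> measurableTypeR R)
    (measurable_quantile m).

Let quantile_distribution (m : probability (measurableTypeR R) R)
  (A : set (measurableTypeR R)) : measurable A ->
  unit_lebesgue (quantile m @^-1` A) = m A.
Proof.
move=> mA.
apply: (eq_probability_distr_fun (distribution unit_lebesgue
  (quantile m : measurableTypeR R -> measurableTypeR R)) m) => // t.
apply: EFin_inj; rewrite distr_funE -unit_lebesgue_quantile_le; congr (unit_lebesgue _).
Qed.

Let quantile_pair (u : measurableTypeR R) : measurableTypeR R * measurableTypeR R :=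
  (quantile mu u, quantile nu u).

Let measurable_quantile_pair : measurable_fun setT quantile_pair.
Proof. by apply: measurable_fun_pair; exact: measurable_quantile. Qed.

HB.instance Definition _ :=
  isMeasurableFun.Build _ _ _ _ quantile_pair measurable_quantile_pair.

Let quantile_coupling : probability (measurableTypeR R * measurableTypeR R)%type R :=
  distribution unit_lebesgue quantile_pair.

(** The quantile coupling is optimal because the events [quantile mu <= t] and
    [quantile nu <= t] are nested for each t: their symmetric difference has
    mass exactly |F t - G t|. *)
Lemma W1_le : (W1 mu nu <= \int[lebesgue_measure]_t (`|F t - G t|)%:E)%E.
Proof.
apply: ge_ereal_inf.
exists (\int[quantile_coupling]_z (`|z.1 - z.2|%R)%:E)%E.
  exists quantile_coupling => // A mA; split; exact: quantile_distribution.
rewrite ge0_integral_distribution//; last first.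
  apply/measurable_EFinP/measurableT_comp => //.
  by apply: measurable_funB; [exact: measurable_fst|exact: measurable_snd].
rewrite (@integral_dist_layer_cake _ _ _ _ _ (measurable_quantile mu)
  (measurable_quantile nu) unit_lebesgue).
rewrite le_eqVlt; apply/orP; left; apply/eqP; apply: eq_integral => t _.
have [F0 F1] := (distr_fun_ge0 mu t, distr_fun_le1 mu t).
have [G0 G1] := (distr_fun_ge0 nu t, distr_fun_le1 nu t).
transitivity (unit_lebesgue
    (`]Num.min (F t) (G t), Num.max (F t) (G t)]%classic : set (measurableTypeR R))).
  rewrite !unit_lebesgueE set_itvoc; congr (lebesgue_measure _).
  apply/seteqP; split => u /= [] + u01; rewrite !quantile_le//= gt_min le_max;
    by rewrite !ltNge -/F -/G; case: (u <= F t); case: (u <= G t).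
rewrite unit_lebesgue_itv ?le_min ?F0 ?G0 ?ge_max ?F1 ?G1//; last first.
  by rewrite ge_min !le_max !lexx.
by have [FG|GF] := leP (F t) (G t); [rewrite ler0_norm ?subr_le0// opprB|
  rewrite gtr0_norm// subr_gt0].
Qed.

Lemma W1E : W1 mu nu = (\int[lebesgue_measure]_t (`|F t - G t|)%:E)%E.
Proof. by apply/eqP; rewrite eq_le W1_le W1_ge. Qed.

End W1E.

(** * Second difference quotients *)

Definition second_quotient {R : realType} (F : R -> R) (h x : R) : R :=
  (2^-1 * (F (x - h) + F (x + h)) - F x) / h.

Lemma measurable_second_quotient {R : realType} (F : R -> R) h :
  measurable_fun setT F -> measurable_fun setT (second_quotient F h).
Proof.
move=> mF; have mFs a : measurable_fun setT (fun x : R => F (x + a)).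
  apply: measurableT_comp => //.
  by apply: measurable_funD => //; exact: measurable_cst.
apply: measurable_funM => //.
apply: measurable_funB => //; apply: measurable_funM => //.
by apply: measurable_funD; exact: mFs.
Qed.

Lemma distr_fun_shift_avg {R : realType}
    (mu : probability (measurableTypeR R) R) (h x : R) :
  distr_fun (shift_avg mu h) x =
  2^-1 * (distr_fun mu (x - h) + distr_fun mu (x + h)).
Proof.
apply: EFin_inj; rewrite distr_funE [LHS]shift_avg_funE EFinM EFinD !distr_funE.
rewrite addeC; congr (_ * (mu _ + mu _))%E;
  by apply/seteqP; split => y /=; rewrite !in_itv/=; lra.
Qed.

(** This turns the statement about transport into one about L^1 norms. *)
Lemma W1_shift_avg {R : realType} (mu : probability (measurableTypeR R) R)
    (h : R) : 0 < h ->
  W1 mu (shift_avg mu h) =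
  (h%:E * \int[lebesgue_measure]_x (`|second_quotient (distr_fun mu) h x|)%:E)%E.
Proof.
move=> h0; rewrite W1E -ge0_integralZl//; last 2 first.
- by apply/measurable_EFinP/measurableT_comp => //;
    apply: measurable_second_quotient; exact: measurable_distr_fun.
- by rewrite lee_fin ltW.
apply: eq_integral => x _; rewrite -EFinM; congr EFin.
rewrite distr_fun_shift_avg distrC /second_quotient normrM normfV (gtr0_norm h0).
by field; rewrite gt_eqF.
Qed.

Section second_quotient_mass.
Context {R : realType} (mu : probability (measurableTypeR R) R).

(** For a nondecreasing function, the average of the two outer values and the
    middle value both lie between the outer values; they even differ by at
    most half of the total increment. *)
Lemma norm_second_quotient_distr_on_le A h x : measurable A -> 0 < h ->
  `|second_quotient (distr_on mu A) h x| <=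
  (distr_on mu A (x + h) - distr_on mu A (x - h)) / (2 * h).
Proof.
move=> mA h0; rewrite /second_quotient normrM normfV (gtr0_norm h0) invfM mulrA.
rewrite ler_pM2r ?invr_gt0//.
have H1 : distr_on mu A (x - h) <= distr_on mu A x.
  by apply: distr_on_nondecreasing => //; lra.
have H2 : distr_on mu A x <= distr_on mu A (x + h).
  by apply: distr_on_nondecreasing => //; lra.
by rewrite ler_norml; apply/andP; split; lra.
Qed.

(** A uniform bound in the step: the increments over ]x - h, x + h] integrate
    to 2 h times the mass, since each point is seen by the x of an interval
    of length 2 h. *)
Lemma integral_second_quotient_distr_on_le A h : measurable A -> 0 < h ->
  (\int[lebesgue_measure]_x (`|second_quotient (distr_on mu A) h x|)%:E <= mu A)%E.
Proof.
move=> mA h0.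
have mD : measurable_fun setT (fun x : R => distr_on mu A (x + h) - distr_on mu A (x - h)).
  by apply: measurable_funB; apply: measurableT_comp (measurable_distr_on mu A mA) _;
    apply: measurable_funD => //; exact: measurable_cst.
have mId a : measurable_fun [set: measurableTypeR R] (fun w : R => w + a).
  by apply: measurable_funD => //; exact: measurable_cst.
apply: (@le_trans _ _ ((2 * h)^-1%:E *
    \int[lebesgue_measure]_x (distr_on mu A (x + h) - distr_on mu A (x - h))%:E)%E).
  rewrite -ge0_integralZl//; last 3 first.
  - exact/measurable_EFinP.
  - by move=> x _; rewrite lee_fin subr_ge0; apply: distr_on_nondecreasing => //; lra.
  - by rewrite lee_fin invr_ge0; lra.
  apply: ge0_le_integral => //.
  - by apply/measurable_EFinP/measurableT_comp => //; apply: measurable_second_quotient;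
      exact: measurable_distr_on.
  - by apply: measurable_funeM; exact/measurable_EFinP.
  - by move=> x _; rewrite -EFinM lee_fin mulrC norm_second_quotient_distr_on_le.
(* The layer-cake formula for w - h and w + h, which are 2 h apart. *)
have layer : ((2 * h)%:E * mu A =
    \int[lebesgue_measure]_x (distr_on mu A (x + h) - distr_on mu A (x - h))%:E)%E.
  have := @integral_dist_layer_cake _ _ _ _ _ (mId (- h)) (mId h) (mrestr mu mA).
  under eq_integral => w _.
    rewrite (_ : `|w - h - (w + h)| = 2 * h); last first.
      by rewrite (_ : w - h - (w + h) = - (2 * h)) ?normrN ?gtr0_norm//; lra.
    over.
  rewrite integral_cst//= /mrestr setTI => ->; apply: eq_integral => x _.
  rewrite distr_onB//; last lra.
  congr (mu (_ `&` _)); apply/seteqP; split => w; rewrite set_itvE /=;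
    rewrite lerBlDr -lerBrDr (leNgt w (x - h)); have [_|w_le] := ltP (x - h) w;
    by rewrite ?addbF// (_ : w <= x + h)//; lra.
rewrite -layer muleA -EFinM mulVf ?mul1e//; lra.
Qed.

End second_quotient_mass.

(** The second difference quotient is half the difference of the quotients
    with steps h and - h, which have the same limit at a point of
    differentiability. *)
Lemma cvg_second_quotient {R : realType} (F : R -> R) (x : R) (h : nat -> R) :
  derivable F x 1 -> (forall n, 0 < h n) -> h n @[n --> \oo] --> (0 : R) ->
  second_quotient F (h n) x @[n --> \oo] --> (0 : R).
Proof.
move=> dF h0 cvgh.
have dq (k : nat -> R) : (forall n, k n != 0) -> k n @[n --> \oo] --> (0 : R) ->
    (k n)^-1 * (F (x + k n) - F x) @[n --> \oo] --> 'D_1 F x.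
  move=> k0 cvgk.
  have k0' : k n @[n --> \oo] --> (0 : R)^'.
    move=> P /cvgk kP; apply: (@filterS _ \oo _ (fun n => k n != 0 -> P (k n))) kP.
    by move=> n; apply; exact: k0.
  have := cvg_comp _ _ k0' dF; apply: cvg_trans; apply: near_eq_cvg.
  by apply: nearW => n /=; rewrite [_%:A]mulr1 (addrC x).
have h_neq0 n : h n != 0 by rewrite gt_eqF.
have Nh_neq0 n : - h n != 0 by rewrite oppr_eq0.
have cvgNh : - h n @[n --> \oo] --> (0 : R) by rewrite -oppr0; exact: cvgN.
have := cvgM (cvg_cst (2^-1 : R))
  (cvgB (dq h h_neq0 cvgh) (dq (fun n => - h n) Nh_neq0 cvgNh)).
rewrite subrr mulr0.
rewrite (_ : (fun n => second_quotient F (h n) x) = fun n => 2^-1 *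
  ((h n)^-1 * (F (x + h n) - F x) - (- h n)^-1 * (F (x - h n) - F x))).
  exact.
by apply/funext => n; rewrite /second_quotient; field.
Qed.

(** * The part of a measure with bounded density *)

(** [N] is the negative part of a Hahn decomposition of mu - c lam, where lam is
    first restricted to [S] so as to be finite. The first inequality also says
    that [mu] has no mass on [N] outside [S]; the second one makes lam small on
    the rest of [S] when c is large. *)
Lemma bounded_density_split d (T : measurableType d) (R : realType)
    (mu : {finite_measure set T -> \bar R})
    (lam : {measure set T -> \bar R}) (S : set T) (c : R) :
    measurable S -> (lam S < +oo)%E -> 0 <= c ->
  exists2 N : set T, measurable N &
    (forall B, measurable B -> (mu (B `&` N) <= c%:E * lam (B `&` S))%E) /\
    (c%:E * lam (S `\` N) <= mu (S `\` N))%E.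
Proof.
move=> mS lamS c0.
pose lamS_ : {finite_measure set T -> \bar R} := mfrestr mS lamS.
pose nu : {charge set T -> \bar R} :=
  cadd (charge_of_finite_measure mu)
       (cscale (- c) (charge_of_finite_measure lamS_)).
have nuE B : nu B = (mu B - c%:E * lam (B `&` S))%E.
  by rewrite /nu/= /cadd/= /cscale/= EFinN mulNe.
have lamS_fin B : measurable B -> lam (B `&` S) \is a fin_num.
  by move=> mB; rewrite -[lam _]/(lamS_ B) fin_num_measure.
have [P [N [[mP posP] [mN negN] PNT PN0]]] := Hahn_decomposition nu.
exists N => //; split.
- move=> B mB.
  have mBN : measurable (B `&` N) by exact: measurableI.
  have := negN _ mBN (@subIsetr _ _ _); rewrite nuE.
  rewrite leeBlDr ?add0e ?fin_numM ?lamS_fin// => /le_trans; apply.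
  apply: lee_wpmul2l; first by rewrite lee_fin.
  apply: le_measure; rewrite ?inE; [exact: measurableI|exact: measurableI|].
  by move=> x [[]].
- have mSN : measurable (S `\` N) by exact: measurableD.
  have SNP : S `\` N `<=` P.
    by move=> x [Sx Nx]; have [] : (P `|` N) x by rewrite PNT.
  have := posP _ mSN SNP; rewrite nuE (_ : (S `\` N) `&` S = S `\` N); last first.
    by rewrite setIidl// => x [].
  by rewrite sube_ge0// fin_num_measure// orbT.
Qed.

Section bounded_density.
Context {R : realType} (mu : probability (measurableTypeR R) R).
Variables (N : set (measurableTypeR R)) (mN : measurable N) (c M : R).
Hypothesis c0 : 0 <= c.
Hypothesis muN : forall B : set (measurableTypeR R), measurable B ->
  (mu (B `&` N) <= c%:E * lebesgue_measure (B `&` `[(- M)%R, M]))%E.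

(** The restriction of [mu] to [N] has a Radon-Nikodym density, so that its
    distribution function is an indefinite integral. *)
Lemma ae_derivable_distr_on :
  {ae lebesgue_measure, forall x : R, derivable (distr_on mu N) x 1}.
Proof.
have dom : mrestr mu mN `<< (@lebesgue_measure R).
  apply/null_content_dominatesP => A mA A0; apply/eqP; rewrite -measure_le0.
  apply: (le_trans (muN _ mA)); rewrite (subset_measure0 _ _ _ A0) ?mule0//.
  exact: measurableI.
have [f [f0 ffin fint fE]] := radon_nikodym_sigma_finite dom.
pose fR := fine \o f.
have fRE : EFin \o fR = f by apply/funext => x; rewrite /fR/= fineK.
have fRint : lebesgue_measure.-integrable setT (EFin \o fR) by rewrite fRE.
have FE : distr_on mu N =
    fun x => (\int[lebesgue_measure]_(t in [set` `]-oo, x]]) fR t)%R.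
  apply/funext => x; rewrite /distr_on /Rintegral; congr fine.
  rewrite [LHS]fE//; apply: eq_integral => t _.
  by rewrite /fR/= fineK.
have fRy y : lebesgue_measure.-integrable `]-oo, y] (EFin \o fR).
  exact: integrableS fRint.
have := FTC1Ny fRy (open_integrable_locally openT fRint).
rewrite FE; apply: filterS; first exact: (ae_filter_ringOfSetsType lebesgue_measure).
by move=> x [].
Qed.

(** The right-hand side is integrable because [mu] has no mass on [N] outside
    [- M, M]; this interval is enlarged by 1 because the step is at most 1. *)
Lemma second_quotient_distr_on_bounded h x : 0 < h -> h <= 1 ->
  `|second_quotient (distr_on mu N) h x| <= c * \1_(`[- M - 1, M + 1]) x.
Proof.
move=> h0 h1; apply: (le_trans (norm_second_quotient_distr_on_le mu N h x mN h0)).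
rewrite ler_pdivrMr; last lra.
rewrite -lee_fin distr_onB//; last lra.
apply: (le_trans (muN _ _)) => //; rewrite -mulrA EFinM.
apply: lee_wpmul2l; first by rewrite lee_fin.
rewrite indicE; case: (boolP (x \in _)) => [_|].
  rewrite mul1r (_ : 2 * h = (x + h) - (x - h)); last lra.
  have <- : lebesgue_measure (`]x - h, x + h]%classic : set R) = (x + h - (x - h))%:E.
    by rewrite lebesgue_measure_itv/= lte_fin ifT//; lra.
  by apply: le_measure; rewrite ?inE//; exact: measurableI.
rewrite notin_setE set_itvcc/= mul0r => xM.
rewrite (_ : _ `&` _ = set0) ?measure0//.
apply/seteqP; split => // y; rewrite !set_itvE/= => -[/andP[? ?] /andP[? ?]].
by apply: xM; apply/andP; split; lra.
Qed.

Lemma cvg_integral_second_quotient_distr_on (h : nat -> R) :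
  (forall n, 0 < h n) -> (forall n, h n <= 1) -> h n @[n --> \oo] --> (0 : R) ->
  (\int[lebesgue_measure]_x (`|second_quotient (distr_on mu N) (h n) x|)%:E
     @[n --> \oo] --> 0)%E.
Proof.
move=> h0 h1 cvgh.
have := @dominated_convergence _ _ R lebesgue_measure setT measurableT
  (fun n x => (`|second_quotient (distr_on mu N) (h n) x|)%:E) (cst 0%E)
  (fun x => (c * \1_(`[- M - 1, M + 1]) x)%:E).
case.
- move=> n; apply/measurable_EFinP/measurableT_comp => //.
  by apply: measurable_second_quotient; exact: measurable_distr_on.
- exact: measurable_cst.
- apply: filterS ae_derivable_distr_on;
    first exact: (ae_filter_ringOfSetsType lebesgue_measure).
  move=> x dx _.
  have := @cvg_second_quotient _ _ _ _ dx h0 cvgh => /(proj2 (norm_cvg0P _)) second_quotient0.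
  by apply: cvg_EFin; [exact: nearW|exact: second_quotient0].
- under [X in _.-integrable _ X]eq_fun do rewrite EFinM.
  by apply: integrableZl => //; exact: integrable_indic_itv.
- apply: aeW => x n _ /=; rewrite normr_id lee_fin.
  exact: second_quotient_distr_on_bounded.
by move=> _ _; rewrite integral0.
Qed.

End bounded_density.

(** * Tightness and approximation of open sets from inside *)

Lemma finite_measure_lt_cap0 d (T : measurableType d) (R : realType)
    (mu : {finite_measure set T -> \bar R}) (A : nat -> set T) (eps : R) :
  (forall n, measurable (A n)) -> (forall n m, (n <= m)%N -> A m `<=` A n) ->
  \bigcap_n A n = set0 -> 0 < eps -> exists n, (mu (A n) < eps%:E)%E.
Proof.
move=> mA ndA A0 eps0.
have : mu (A n) @[n --> \oo] --> mu (\bigcap_n A n).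
  apply: nonincreasing_cvg_mu => //.
  - by rewrite -ge0_fin_numE// fin_num_measure.
  - exact: bigcap_measurable.
  - by move=> n m nm; apply/subsetPset; exact: ndA.
rewrite A0 measure0 => /fine_cvgP[_ /cvgrPdist_lt/(_ _ eps0)[n _ /(_ n (leqnn n))]].
rewrite sub0r normrN/= ger0_norm ?fine_ge0// => ltn; exists n.
by rewrite -(@fineK _ (mu (A n))) ?lte_fin// fin_num_measure.
Qed.

Section tightness.
Context {R : realType} (mu : {finite_measure set (measurableTypeR R) -> \bar R}).

Lemma finite_measure_tight (eps : R) : 0 < eps ->
  exists M : R, (mu (~` `[(- M)%R, M]) < eps%:E)%E.
Proof.
move=> eps0.
have [||||n] :=
    @finite_measure_lt_cap0 _ _ _ mu (fun n => ~` `[- n%:R, n%:R]) eps.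
- by move=> n; exact: measurableC.
- move=> n m nm x /=; apply: contra_not; rewrite !in_itv/= => /andP[nx xn].
  by rewrite (le_trans _ nx) ?(le_trans xn) ?lerN2 ?ler_nat.
- rewrite -setC_bigcup -subset0 => x /=; apply.
  exists (Num.bound `|x|) => //=; rewrite in_itv/= -ler_norml.
  exact/ltW/archi_boundP/normr_ge0.
- by [].
by exists n%:R.
Qed.

(** The points of [U] at distance at least [r] from its complement; these sets
    exhaust an open [U] as [r] decreases to 0. *)
Definition erosion (U : set R) (r : R) : set R := [set x | ball x r `<=` U].

Lemma measurable_erosion U r : 0 < r ->
  measurable (erosion U r : set (measurableTypeR R)).
Proof.
move=> r0; rewrite -(setCK (erosion U r)); apply: measurableC.
apply: open_measurable.
have -> : ~` erosion U r = \bigcup_(y in ~` U) ball y r.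
  apply/seteqP; split => x /=.
    rewrite /erosion/= => /existsNP[y /not_implyP[xy Uy]].
    by exists y => //; exact: ball_sym.
  by move=> [y Uy yx] /(_ y) H; apply: Uy; apply: H; exact: ball_sym.
by apply: bigcup_open => y _; exact: ball_open.
Qed.

Lemma finite_measure_erosion U (eps : R) : open U -> 0 < eps ->
  exists2 r : R, 0 < r & (mu (U `\` erosion U r) < eps%:E)%E.
Proof.
move=> oU eps0.
have [||||n] :=
  @finite_measure_lt_cap0 _ _ _ mu (fun n => U `\` erosion U n.+1%:R^-1) eps.
- by move=> n; apply: measurableD; [exact: open_measurable|exact: measurable_erosion].
- move=> n m nm x [Ux xm]; split=> // xn; apply: xm => y xy; apply: xn.
  by apply: le_ball xy; rewrite lef_pV2 ?posrE// ler_nat.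
- rewrite -subset0 => x /= xE; have [Ux _] := xE 0%N Logic.I.
  have /nbhs_ballP[r /= r0 rU] : nbhs x U by exact: open_nbhs_nbhs.
  have [n nr] : exists n : nat, n.+1%:R^-1 < r.
    exists (Num.bound r^-1); rewrite -[ltRHS]invrK ltf_pV2 ?posrE ?invr_gt0//.
    have : r^-1 < (Num.bound r^-1)%:R by apply: archi_boundP; rewrite invr_ge0 ltW.
    by move=> /lt_trans; apply; rewrite ltr_nat.
  have [_] := xE n Logic.I; apply => y xy; apply: rU.
  by apply: le_ball xy; exact: ltW.
- by [].
by exists n.+1%:R^-1.
Qed.

End tightness.

(** * Domination forces convergence *)

Section dominated.
Context {R : realType} (mu : probability (measurableTypeR R) R).
Local Notation lam := (@lebesgue_measure R).

Lemma second_quotientD (F G : R -> R) h x :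
  second_quotient (F \+ G) h x = second_quotient F h x + second_quotient G h x.
Proof. by rewrite /second_quotient -mulrDl; congr (_ / _) => /=; ring. Qed.

(** No point of [A] is within distance [h] of [x], so that the distribution
    function is constant on [x - h, x + h]. *)
Lemma second_quotient_distr_on_off (U A : set R) (r h x : R) :
  measurable (A : set (measurableTypeR R)) -> A `<=` erosion U r ->
  0 < h -> h < r -> ~ U x -> second_quotient (distr_on mu A) h x = 0.
Proof.
move=> mA AU h0 hr Ux.
have cstF a b : a <= b -> x - h <= a -> b <= x + h ->
    distr_on mu A b = distr_on mu A a.
  move=> ab ha bh; apply/eqP; rewrite -subr_eq0 -eqe distr_onB//.
  rewrite (_ : _ `&` _ = set0) ?measure0//.
  apply/seteqP; split => // y [+ Ay]; rewrite set_itvE/= => /andP[ay yb].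
  apply: Ux; apply: (AU _ Ay); rewrite /ball/= ltr_distl; apply/andP; split; lra.
rewrite /second_quotient (cstF x (x + h)) ?(cstF (x - h) x); lra.
Qed.

(** An approximate Lebesgue decomposition: [mu] has a bounded density on [N],
    [E] carries what concentrates on a small set, and [Q] what is lost.
    Requiring [E] to be inside an erosion of [U], and not only inside [U],
    makes the quotients of the part carried by [E] vanish outside [U] for
    small steps. *)
Lemma concentration_split (eps d : R) : 0 < eps -> 0 < d ->
  exists N E Q U : set (measurableTypeR R), exists c M r : R,
    [/\ [/\ measurable N, measurable E, measurable Q & measurable U],
        distr_fun mu = (distr_on mu N \+ distr_on mu E) \+ distr_on mu Q,
        0 <= c /\ (forall B : set (measurableTypeR R), measurable B ->
          (mu (B `&` N) <= c%:E * lam (B `&` `[(- M)%R, M]))%E),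
        [/\ (lam U < d%:E)%E, E `<=` erosion U r & 0 < r] &
        (mu Q <= eps%:E)%E].
Proof.
move=> eps0 d0.
have e20 : 0 < eps / 2 by rewrite divr_gt0.
have [M muM] := finite_measure_tight mu _ e20.
pose S : set (measurableTypeR R) := `[- M, M]%classic.
have mS : measurable S by exact: measurable_itv.
have lamS : (lam S < +oo)%E.
  by rewrite lebesgue_measure_itv/=; case: ifP; rewrite -?EFinB ltry.
(* With c = 2 / d, the set S minus N has Lebesgue measure at most d / 2. *)
have c0 : 0 <= 2 / d by rewrite divr_ge0// ltW.
have [N mN [muN SN]] := bounded_density_split _ _ _ mu lam S (2 / d) mS lamS c0.
pose D := S `\` N.
have mD : measurable D by exact: measurableD.
have lamD : (lam D <= (d / 2)%:E)%E.
  have : ((2 / d)%:E * lam D <= 1)%E.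
    by apply: (le_trans SN); exact: probability_le1.
  rewrite -lee_pdivlMl ?divr_gt0// mule1 => /le_trans; apply.
  by rewrite lee_fin invf_div.
have lamDoo : (lam D < +oo)%E by rewrite (le_lt_trans lamD) ?ltry.
have d20 : 0 < d / 2 by rewrite divr_gt0.
have [U [oU DU UD]] := lebesgue_regularity_outer mD lamDoo d20.
have mU : measurable (U : set (measurableTypeR R)) by exact: open_measurable.
have [r r0 muUr] := finite_measure_erosion mu U _ oU e20.
have mUr := measurable_erosion U _ r0.
pose E := erosion U r `\` N.
pose Q := ~` N `\` E.
have mE : measurable (E : set (measurableTypeR R)) by exact: measurableD.
have mQ : measurable (Q : set (measurableTypeR R)).
  by apply: measurableD => //; exact: measurableC.
exists N, E, Q, U, (2 / d), M, r; split => //.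
- have NE : [disjoint N & E] by apply/disj_setPS => x [Nx [_]].
  have NEQ : [disjoint N `|` E & Q] by apply/disj_setPS => x [[Nx|Ex] []].
  rewrite -distr_onT -(distr_onU mu N E)// -distr_onU//; last exact: measurableU.
  congr (distr_on mu _); apply/seteqP; split => // x _.
  have [Nx|Nx] := pselect (N x); first by left; left.
  by have [Ex|Ex] := pselect (E x); [left; right|right].
- split => //; last by move=> x [].
  rewrite -(setDUK DU) (le_lt_trans (measureU2 _ _ _))//.
    exact: measurableD.
  by rewrite [d]splitr EFinD; apply: lee_ltD => //; rewrite ge0_fin_numE.
- have QSU : Q `<=` ~` S `|` (U `\` erosion U r).
    move=> x [Nx Ex]; have [Sx|Sx] := pselect (S x); last by left.
    by right; split; [exact: DU|move=> Ux; exact: Ex].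
  apply: (@le_trans _ _ (mu (~` S `|` (U `\` erosion U r)))).
    by apply: le_measure; rewrite ?inE//; apply: measurableU;
      [exact: measurableC|exact: measurableD].
  apply: le_trans (measureU2 _ _ _) _.
  + exact: measurableC.
  + exact: measurableD.
  + by rewrite [eps]splitr EFinD; apply: leeD; exact: ltW.
Qed.

(** Over [U], the quotients of the whole distribution function are bounded by
    [g], whose integral there is small; outside [U], only the parts carried by
    [N] and [Q] contribute. *)
Lemma dominated_second_quotient (g : R -> R) (h : nat -> R) (eps : R) :
  lam.-integrable setT (EFin \o g) ->
  (forall n, 0 < h n) -> (forall n, h n <= 1) -> h n @[n --> \oo] --> (0 : R) ->
  {ae lam, forall x : R, forall n, `|second_quotient (distr_fun mu) (h n) x| <= g x} ->
  0 < eps ->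
  \forall n \near \oo,
    (\int[lam]_x (`|second_quotient (distr_fun mu) (h n) x|)%:E <= eps%:E)%E.
Proof.
move=> gint h0 h1 cvgh hg eps0.
have e30 : 0 < eps / 3 by rewrite divr_gt0.
have [d [d0 gd]] := integral_normr_continuous gint e30.
have [N [E [Q [U [c [M [r [[mN mE mQ mU] FE [c0 muN] [Ud EU r0] muQ]]]]]]]] :=
  concentration_split _ _ e30 d0.
have := cvg_integral_second_quotient_distr_on mu N mN c M c0 muN h h0 h1 cvgh.
move=> /fine_cvgP[Nfin] /cvgrPdist_lt/(_ _ e30) Nlt.
have /cvgrPdist_lt/(_ _ r0) hr := cvgh.
near=> n.
have hnr : h n < r.
  have : `|0 - h n| < r by near: n.
  by rewrite sub0r normrN gtr0_norm.
have Nn : (\int[lam]_x (`|second_quotient (distr_on mu N) (h n) x|)%:E <= (eps / 3)%:E)%E.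
  rewrite -[leLHS]fineK; last by near: n.
  rewrite lee_fin; apply: le_trans (ler_norm _) (ltW _).
  by rewrite -normrN -sub0r; near: n.
have msd A : measurable A ->
    measurable_fun setT (fun x => (`|second_quotient (distr_on mu A) (h n) x|)%:E).
  move=> mA; apply/measurable_EFinP/measurableT_comp => //.
  by apply: measurable_second_quotient; exact: measurable_distr_on.
pose u := ((fun x : R => (`|g x|)%:E) \_ U)%E.
have gabs : lam.-integrable setT (fun x => (`|g x|)%:E) by exact: integrable_norm.
have mu_u : measurable_fun setT u.
  by apply/(measurable_restrictT _ _).1 => //; apply: measurable_funTS; case/integrableP: gabs.
have u0 x : (0 <= u x)%E by rewrite /u patchE; case: ifP => // _; rewrite lee_fin.
have int_u : (\int[lam]_x u x <= (eps / 3)%:E)%E.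
  rewrite -integral_mkcond -[leLHS]fineK.
    by rewrite lee_fin; exact/ltW/(gd _ mU Ud).
  by apply: integrable_fin_num => //; apply: integrableS gabs.
(* The part carried by E is absent from this bound: it only acts inside U. *)
apply: (@le_trans _ _ (\int[lam]_x (u x + (`|second_quotient (distr_on mu N) (h n) x|)%:E +
   (`|second_quotient (distr_on mu Q) (h n) x|)%:E))%E).
  apply: ae_ge0_le_integral => //.
  - by rewrite -distr_onT; exact: msd.
  - by move=> x _; rewrite !adde_ge0 ?lee_fin.
  - by apply: emeasurable_funD; [apply: emeasurable_funD|]; rewrite //; exact: msd.
  apply: filterS hg; first exact: (ae_filter_ringOfSetsType lam).
  move=> x hgx _.
  have [Ux|Ux] := pselect (U x).
    rewrite -addeA lee_paddr ?adde_ge0 ?lee_fin// /u patchE mem_set//.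
    by rewrite lee_fin (le_trans (hgx n))// ler_norm.
  rewrite /u patchE memNset// add0e -EFinD lee_fin FE !second_quotientD.
  rewrite (second_quotient_distr_on_off U E r)// addr0; exact: ler_normD.
rewrite ge0_integralD//; last 3 first.
- by move=> x _; rewrite adde_ge0 ?lee_fin.
- by apply: emeasurable_funD => //; exact: msd.
- exact: msd.
rewrite ge0_integralD//; last exact: msd.
rewrite (_ : eps = eps / 3 + eps / 3 + eps / 3); last by field.
rewrite !EFinD; apply: leeD; first exact: leeD.
exact: le_trans (integral_second_quotient_distr_on_le mu Q (h n) mQ (h0 n)) muQ.
Unshelve. all: by end_near. Qed.

End dominated.

(** * Extraction of sequences and the equivalence *)

Lemma eventually_subsequence (P : nat -> nat -> Prop) :
  (forall k, \forall n \near \oo, P k n) ->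
  exists2 phi : nat -> nat, increasing_seq phi & forall k, P k (phi k).
Proof.
move=> nearP.
have /choice[N PN] : forall k, exists N, forall n, (N <= n)%N -> P k n.
  by move=> k; have [N _ PN] := nearP k; exists N.
pose phi := fix phi k :=
  if k is k'.+1 then maxn (N k) (phi k').+1 else N 0%N.
exists phi.
  by apply/increasing_seqP => k /=; rewrite ltEnat/= leq_maxr.
by move=> k; apply: PN; case: k => //= k; exact: leq_maxl.
Qed.

Lemma summable_dominated d (T : measurableType d) (R : realType)
    (m : {measure set T -> \bar R}) (f : nat -> T -> R) :
  (forall k, measurable_fun setT (f k)) -> (forall k x, 0 <= f k x) ->
  (forall k, (\int[m]_x (f k x)%:E <= (1 / (2 ^ k.+1)%:R)%:E)%E) ->
  exists g : T -> R, [/\ m.-integrable setT (EFin \o g), forall x, 0 <= g x &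
    {ae m, forall x k, f k x <= g x}].
Proof.
move=> mf f0 fint.
pose G x := (\sum_(k <oo) (f k x)%:E)%E.
have G0 x : (0 <= G x)%E by apply: nneseries_ge0 => k _ _; rewrite lee_fin.
have mG : measurable_fun setT G.
  by apply: ge0_emeasurable_sum => [k x _ _|k _]; [rewrite lee_fin|exact/measurable_EFinP].
have Goo : (\int[m]_x G x < +oo)%E.
  rewrite integral_nneseries//; last 2 first.
  - by move=> k; exact/measurable_EFinP.
  - by move=> k x _; rewrite lee_fin.
  apply: (@le_lt_trans _ _ 1%E); last exact: ltry.
  apply: le_trans (@epsilon_trick0 R 1 xpredT ler01).
  by apply: lee_nneseries => // k _ _; apply: integral_ge0 => x _; rewrite lee_fin.
have Gint : m.-integrable setT G.
  by apply/integrableP; split => //; under eq_integral do rewrite gee0_abs//.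
(* Where the series diverges, fine gives 0; this is a null set. *)
exists (fine \o G); split; last 2 first.
- by move=> x /=; exact: fine_ge0.
- apply: filterS (integrable_ae measurableT Gint).
  move=> x /(_ Logic.I) Gfin k /=.
  rewrite -lee_fin fineK// /G (@nneseriesD1 _ _ k)//; last by move=> *; rewrite lee_fin.
  by rewrite leeDl// nneseries_ge0// => *; rewrite lee_fin.
apply: (le_integrable measurableT _ _ Gint).
  by apply/measurable_EFinP/measurableT_comp.
move=> x _ /=; rewrite ger0_norm ?fine_ge0// gee0_abs//.
by have [->|] := eqVneq (G x) +oo%E; [rewrite leey|
  rewrite -ltey => Gx; rewrite fineK// ge0_fin_numE].
Qed.

(** Each term is chosen below both the previous one and 1 / (n + 1), which makes
    the sequence monotone and vanishing. *)
Lemma bad_vanishing_seq (R : realType) (P : R -> Prop) :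
  ~ (\forall h \near 0^'+, P h) ->
  exists h : nat -> R, [/\ vanishing_seq h, forall n, h n \in `]0, 1] &
    forall n, ~ P (h n)].
Proof.
move=> nP.
(* The premise 0 < d is put inside the existential to apply choice. *)
have bad (d : R) : exists h, 0 < d -> [/\ 0 < h, h < d & ~ P h].
  have [d0|d0] := ltP 0 d; last by exists 0 => d0'; lra.
  apply: contrapT => nbad; apply: nP; near=> h.
  have h0 : 0 < h by near: h; exact: nbhs_right_gt.
  have hd : h < d by near: h; exact: nbhs_right_lt.
  by apply: contrapT => Ph; apply: nbad; exists h.
have /choice[b bP] := bad.
pose h := fix h n := if n is n'.+1 then b (Num.min (h n') n.+1%:R^-1) else b 1.
have hP n : 0 < h n /\ ~ P (h n).
  elim: n => [|n [hn _]] /=; first by have [] := bP 1 ltr01.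
  by have [|? _ ?] := bP (Num.min (h n) n.+2%:R^-1); rewrite ?lt_min ?hn/=.
have hS n : h n.+1 < Num.min (h n) n.+2%:R^-1.
  by have [|] := bP (Num.min (h n) n.+2%:R^-1); rewrite ?lt_min ?(hP n).1/=.
have hlt n : h n < n.+1%:R^-1.
  case: n => [|n]; first by rewrite invr1; have [] := bP 1 ltr01.
  by have := hS n; rewrite lt_min => /andP[].
have ndh : nonincreasing_seq h.
  apply/nonincreasing_seqP => n; have := hS n.
  by rewrite lt_min => /andP[/ltW].
exists h; split; last by move=> n; exact: (hP n).2.
- split=> //; first by move=> n; exact: (hP n).1.
  apply: (@squeeze_cvgr _ _ _ _ (cst 0) (@harmonic R)).
  + by apply: nearW => n; rewrite (ltW (hP n).1) ltW//; exact: hlt.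
  + exact: cvg_cst.
  + exact: cvg_harmonic.
- move=> n; rewrite in_itv/= (hP n).1/= (le_trans (ltW (hlt n)))//.
  by rewrite invf_le1// ler1n.
Unshelve. all: by end_near. Qed.

Theorem theorem3 (R : realType) (mu : probability (measurableTypeR R) R) :
  (forall eps : R, 0 < eps ->
     \forall h \near 0^'+, (W1 mu (shift_avg mu h) <= (eps * h)%:E)%E)
  <->
  (forall h : nat -> R, vanishing_seq h -> (forall n, h n \in `]0, 1]) ->
     exists phi : nat -> nat, exists g : R -> R,
       [/\ increasing_seq phi,
           lebesgue_measure.-integrable [set: measurableTypeR R] (EFin \o g),
           forall x, 0 <= g x
         & {ae lebesgue_measure, forall x : measurableTypeR R, forall k : nat,
              `| (2^-1 * (distr_fun mu (x - h (phi k)) +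
                          distr_fun mu (x + h (phi k))) -
                  distr_fun mu x) / h (phi k) | <= g x}]).
Proof.
split=> [littleoW1 h [_ h0 cvgh] _|dominated].
  have [|phi phi_incr phiP] := @eventually_subsequence (fun k n =>
    (W1 mu (shift_avg mu (h n)) <= (1 / (2 ^ k.+1)%:R * h n)%:E)%E).
    move=> k; have k0 : 0 < 1 / (2 ^ k.+1)%:R :> R.
      by rewrite divr_gt0// ltr0n expn_gt0.
    apply: (@filterS _ \oo _ (fun n => 0 < h n ->
      (W1 mu (shift_avg mu (h n)) <= (1 / (2 ^ k.+1)%:R * h n)%:E)%E)).
      by move=> n; apply; exact: h0.
    exact: cvgh _ (littleoW1 _ k0).
  have [|||g [gint g0 fg]] := @summable_dominated _ (measurableTypeR R) R
    lebesgue_measure (fun k x => `|second_quotient (distr_fun mu) (h (phi k)) x|).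
  - move=> k; apply: measurableT_comp => //.
    by apply: measurable_second_quotient; exact: measurable_distr_fun.
  - by [].
  - move=> k; have := phiP k; rewrite W1_shift_avg// (mulrC _ (h (phi k))) EFinM.
    by rewrite lee_pmul2l// lte_fin.
  by exists phi, g.
move=> eps eps0; apply: contrapT => /bad_vanishing_seq[h [hv h01 bad]].
have [phi [g [phi_incr gint g0 hg]]] := dominated h hv h01.
have [_ h0 cvgh] := hv.
have cvghphi : h (phi n) @[n --> \oo] --> (0 : R).
  apply: cvg_comp cvgh => A [n _ nA]; exists n => // m /= nm; apply: nA => /=.
  apply: (leq_trans nm).
  elim: m {nm} => // m /leq_ltn_trans; apply.
  by move/increasing_seqP : phi_incr; exact.
have := dominated_second_quotient mu g (h \o phi) eps gint _ _ cvghphi hg eps0.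
case=> [n|n|n _ /(_ n (leqnn n)) le_eps]; first exact: h0.
  by have := h01 (phi n); rewrite in_itv/= => /andP[].
apply: (bad (phi n)); rewrite W1_shift_avg// mulrC EFinM.
by rewrite lee_pmul2l// lte_fin.
Qed.
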